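(* Let $k\ge 2$ be an integer and let $R\in[1/2,1)$. Let $E_k=\{\boldsymbol\theta=(\theta_1,\dots,\theta_k)\in\mathbb{R}^k:\ \theta_i\ge 0\ \forall i,\ \sum_{i=1}^k\theta_i=1\}$ and $\Omega_{k,R}=\{\boldsymbol\theta\in E_k:\ |\boldsymbol\theta|^2\le R\}$. Then $$\frac{\mathrm{Vol}(\Omega_{k,R})}{\mathrm{Vol}(E_k)}\ge 1-k\left(\frac{R-\sqrt{2R-1}}{2}\right)^{\frac{k-1}{2}}.$$ Additionally, for fixed $R\in[1/2,1)$, $\frac{\mathrm{Vol}(\Omega_{k,R})}{\mathrm{Vol}(E_k)}\to 1$ as $k\to\infty$.
   Context: $|\boldsymbol\theta|^2=\sum_{i=1}^k\theta_i^2$ is the squared Euclidean norm, and $\mathrm{Vol}$ denotes $(k-1)$-dimensional volume (surface area, i.e. $(k-1)$-dimensional Hausdorff measure) on the $(k-1)$-dimensional simplex $E_k\subset\mathbb{R}^k$. *)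

(* Defs.v *)
From mathcomp Require Import all_boot all_order all_algebra.
From mathcomp Require Import all_classical all_reals all_analysis.

Set Implicit Arguments.
Unset Strict Implicit.
Unset Printing Implicit Defensive.

Import Order.TTheory GRing.Theory Num.Theory.
Import numFieldNormedType.Exports.

Local Open Scope classical_set_scope.
Local Open Scope ring_scope.

(* The library norm on 'rV[R]_k is the sup norm, and the library has no
   Hausdorff measure; both Euclidean distances and the Hausdorff measure they
   induce on R^k are therefore set up here. *)

Definition sqnorm (R : realType) (k : nat) (x : 'rV[R]_k) : R :=
  \sum_(i < k) x 0 i ^+ 2.

Definition euclid_dist (R : realType) (k : nat) (x y : 'rV[R]_k) : R :=
  Num.sqrt (sqnorm (x - y)).

(* The maximum with 0 only serves to give the empty set diameter 0, since
   ereal_sup set0 = -oo. *)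
Definition diam (R : realType) (k : nat) (U : set 'rV[R]_k) : \bar R :=
  maxe 0%E (ereal_sup [set (euclid_dist p.1 p.2)%:E | p in U `*` U]).

(* diam(U)^n, with value 0 at the empty set: this matters for n = 0 only,
   where a nonempty U has weight 1 whatever its diameter. *)
Definition diam_pow (R : realType) (k n : nat) (U : set 'rV[R]_k) : \bar R :=
  if U == set0 then 0%E else (diam U ^+ n)%E.

Definition delta_cover (R : realType) (k : nat) (delta : R)
    (A : set 'rV[R]_k) (U : nat -> set 'rV[R]_k) : Prop :=
  A `<=` \bigcup_i U i /\ forall i, (diam (U i) <= delta%:E)%E.

Definition hausdorff_content (R : realType) (k n : nat) (delta : R)
    (A : set 'rV[R]_k) : \bar R :=
  ereal_inf [set (\sum_(0 <= i <oo) diam_pow n (U i))%E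
            | U in [set U | delta_cover delta A U]].

(* Lebesgue measure of the unit ball of R^n:
   omega_0 = 1, omega_1 = 2, omega_n = (2 pi / n) omega_(n-2). *)
Fixpoint unit_ball_volume (R : realType) (n : nat) : R :=
  match n with
  | 0%N => 1
  | 1%N => 2
  | m.+2 => 2 * pi / m.+2%:R * unit_ball_volume R m
  end.

(* The factor omega_n / 2^n is the usual normalization, for which H^n is
   Lebesgue measure on R^n and the surface measure on n-dimensional surfaces. *)
Definition hausdorff_measure (R : realType) (k n : nat)
    (A : set 'rV[R]_k) : \bar R :=
  ((unit_ball_volume R n / 2 ^+ n)%:E *
   ereal_sup [set hausdorff_content n delta A
             | delta in [set delta : R | (0 < delta)%R]])%E.

Definition Vol (R : realType) (k : nat) (A : set 'rV[R]_k) : \bar R :=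
  hausdorff_measure k.-1 A.

Definition simplex (R : realType) (k : nat) : set 'rV[R]_k :=
  [set theta | (forall i, 0 <= theta 0 i) /\ \sum_(i < k) theta 0 i = 1].
Arguments simplex : clear implicits.

Definition Omega (R : realType) (k : nat) (r : R) : set 'rV[R]_k :=
  [set theta | simplex R k theta /\ sqnorm theta <= r].
Arguments Omega {R} k r _.

(* Main.v *)
(* Among the points of the simplex, [|theta|^2 <= theta_i] and
   [|theta|^2 <= theta_i^2 + (1 - theta_i)^2] where [theta_i] is the largest
   coordinate. So [|theta|^2 > r] forces [theta_i >= 1 - t] for the smaller root
   [t] of [t^2 + (1 - t)^2 = r], and the complement of [Omega] is covered by [k]
   homothetic copies of the simplex of ratio [t]. Subadditivity and homogeneity
   of the Hausdorff measure give [Vol E <= Vol Omega + k t^(k-1) Vol E], and one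
   may divide because [0 < Vol E < +oo]. Finiteness comes from covering the
   simplex by the cells of a grid. For positivity, a cover of the simplex
   projects to a cover of the cube [0, 1/n]^n; by compactness finitely many
   slightly enlarged boxes suffice, and counting the points of a fine grid in
   each of them bounds the sum of [diam^n] from below. *)
Require Import Defs.
From mathcomp Require Import all_boot all_order all_algebra.
From mathcomp Require Import all_classical all_reals all_analysis.
From mathcomp Require Import lra ring zify.

Import Order.TTheory GRing.Theory Num.Theory.
Import numFieldNormedType.Exports.

Local Open Scope classical_set_scope.
Local Open Scope ring_scope.

Set Implicit Arguments.
Unset Strict Implicit.
Unset Printing Implicit Defensive.

(** * Euclidean distances, diameters, and their scaling under homotheties *)

Section Diameter.
Context (R : realType) (k : nat).
Implicit Types (x y v : 'rV[R]_k) (U V A B : set 'rV[R]_k) (t d e : R).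

Lemma lee_exp2 (a b : \bar R) n : (0 <= a)%E -> (a <= b)%E -> (a ^+ n <= b ^+ n)%E.
Proof.
move=> a0 ab; elim: n => [|n IH]; first by rewrite !expe0.
by rewrite !expeS lee_pmul// expe_ge0.
Qed.

Lemma expeZ t (a : \bar R) n : 0 <= t -> (0 <= a)%E ->
  ((t%:E * a) ^+ n = (t ^+ n)%:E * a ^+ n)%E.
Proof.
move=> t0 a0; elim: n => [|n IH]; first by rewrite !expe0 expr0 mule1.
by rewrite !expeS IH exprS EFinM muleACA.
Qed.

Lemma coord_le_euclid_dist x y i : `|x 0 i - y 0 i| <= euclid_dist x y.
Proof.
rewrite /euclid_dist -sqrtr_sqr ler_wsqrtr// /sqnorm (bigD1 i)//= !mxE.
by rewrite lerDl sumr_ge0// => j _; exact: sqr_ge0.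
Qed.

(** The sharp factor would be the square root of [k]; the cruder [k], from [k <= k ^ 2], is enough
    to prove finiteness. *)
Lemma euclid_dist_le x y e : 0 <= e -> (forall i, `|x 0 i - y 0 i| <= e) ->
  euclid_dist x y <= k%:R * e.
Proof.
move=> e0 h; have ke0 : 0 <= k%:R * e by rewrite mulr_ge0.
rewrite /euclid_dist -(ger0_norm ke0) -sqrtr_sqr ler_wsqrtr// /sqnorm.
apply: (@le_trans _ _ (\sum_(i < k) e ^+ 2)).
  by apply: ler_sum => i _; rewrite !mxE -[leLHS]real_normK ?num_real// lerXn2r ?nnegrE.
rewrite sumr_const card_ord -(mulr_natl (e ^+ 2)) exprMn ler_wpM2r ?sqr_ge0//.
by rewrite -natrX ler_nat; case: k => // m; rewrite leq_pmulr.
Qed.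

Lemma euclid_dist_homothety t v x y : 0 <= t ->
  euclid_dist (t *: x + v) (t *: y + v) = t * euclid_dist x y.
Proof.
move=> t0; rewrite /euclid_dist -[in RHS](ger0_norm t0) -sqrtr_sqr.
rewrite -sqrtrM ?sqr_ge0//; congr Num.sqrt; rewrite /sqnorm mulr_sumr.
by apply: eq_bigr => i _; rewrite !mxE -exprMn; congr (_ ^+ 2); ring.
Qed.

Lemma diam_ge0 U : (0 <= diam U)%E.
Proof. by rewrite /diam le_max lexx. Qed.

Lemma euclid_dist_le_diam U x y : U x -> U y -> ((euclid_dist x y)%:E <= diam U)%E.
Proof.
move=> Ux Uy; rewrite /diam le_max; apply/orP; right.
by apply: ereal_sup_ubound; exists (x, y).
Qed.

Lemma diam_le U (d : \bar R) : (0 <= d)%E ->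
  (forall x y, U x -> U y -> ((euclid_dist x y)%:E <= d)%E) -> (diam U <= d)%E.
Proof.
move=> d0 h; rewrite /diam ge_max d0/=; apply: ge_ereal_sup => _ [[x y] [Ux Uy] <-].
exact: h.
Qed.

Lemma diam_set0 : diam (set0 : set 'rV[R]_k) = 0%E.
Proof. by apply/eqP; rewrite eq_le diam_ge0 andbT; exact: diam_le. Qed.

Lemma diam_pow_ge0 n U : (0 <= diam_pow n U)%E.
Proof. by rewrite /diam_pow; case: ifP => // _; rewrite expe_ge0// diam_ge0. Qed.

Lemma diam_pow_set0 n : diam_pow n (set0 : set 'rV[R]_k) = 0%E.
Proof. by rewrite /diam_pow eqxx. Qed.

Lemma diam_powE n U : (0 < n)%N -> diam_pow n U = (diam U ^+ n)%E.
Proof.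
case: n => // n _; rewrite /diam_pow; case: eqP => // ->.
by rewrite diam_set0 expeS mul0e.
Qed.

Lemma diam_homothety t v U : 0 <= t ->
  (diam [set (t *: x + v)%R | x in U] <= t%:E * diam U)%E.
Proof.
move=> t0; apply: diam_le => [|_ _ [x Ux <-] [y Uy <-]].
  by rewrite mule_ge0// diam_ge0.
by rewrite euclid_dist_homothety// EFinM lee_wpmul2l// euclid_dist_le_diam.
Qed.

Lemma diam_pow_homothety n t v U : 0 <= t ->
  (diam_pow n [set (t *: x + v)%R | x in U] <= (t ^+ n)%:E * diam_pow n U)%E.
Proof.
move=> t0; rewrite /diam_pow; case: ifPn => [_|].
  by rewrite mule_ge0 ?lee_fin ?exprn_ge0//; exact: diam_pow_ge0.
case: ifPn => [/eqP ->|_ _]; first by rewrite image_set0 eqxx.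
rewrite -expeZ ?diam_ge0// lee_exp2 ?diam_ge0//; exact: diam_homothety.
Qed.

End Diameter.

(** * Monotonicity, subadditivity and homogeneity of the Hausdorff measure *)

Section HausdorffMeasure.
Context (R : realType) (k n : nat).
Implicit Types (v : 'rV[R]_k) (A B : set 'rV[R]_k) (U V : nat -> set 'rV[R]_k) (t d delta : R).

Lemma nneseries_le (u : nat -> \bar R) (M : \bar R) : (forall i, 0 <= u i)%E ->
  (forall m, \sum_(0 <= i < m) u i <= M)%E -> (\sum_(0 <= i <oo) u i <= M)%E.
Proof.
move=> u0 uM; apply: lime_le; first exact: is_cvg_nneseries.
by near=> m; exact: uM.
Unshelve. all: by end_near. Qed.

Lemma hausdorff_content_ge0 delta A : (0 <= hausdorff_content n delta A)%E.
Proof.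
apply: le_ereal_inf_tmp => _ [U _ <-].
by apply: nneseries_ge0 => i _ _; exact: diam_pow_ge0.
Qed.

Lemma hausdorff_content_le delta A U : delta_cover delta A U ->
  (hausdorff_content n delta A <= \sum_(0 <= i <oo) diam_pow n (U i))%E.
Proof. by move=> AU; apply: ereal_inf_lbound; exists U. Qed.

Lemma hausdorff_contentS delta A B : A `<=` B ->
  (hausdorff_content n delta A <= hausdorff_content n delta B)%E.
Proof.
move=> AB; apply: le_ereal_inf_tmp => _ [U [BU dU] <-].
by apply: hausdorff_content_le; split => //; exact: subset_trans BU.
Qed.

Lemma hausdorff_contentU delta A B :
  (hausdorff_content n delta (A `|` B) <=
   hausdorff_content n delta A + hausdorff_content n delta B)%E.
Proof.
have [->|Afin] := eqVneq (hausdorff_content n delta A) +oo%E.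
  by rewrite addye ?leey// gt_eqF// (lt_le_trans _ (hausdorff_content_ge0 _ _)).
have [->|Bfin] := eqVneq (hausdorff_content n delta B) +oo%E.
  by rewrite addey ?leey// gt_eqF// (lt_le_trans _ (hausdorff_content_ge0 _ _)).
have {}Afin : hausdorff_content n delta A \is a fin_num.
  by rewrite ge0_fin_numE ?hausdorff_content_ge0// ltey.
have {}Bfin : hausdorff_content n delta B \is a fin_num.
  by rewrite ge0_fin_numE ?hausdorff_content_ge0// ltey.
apply/lee_addgt0Pr => e e0; have e20 : 0 < e / 2 by rewrite divr_gt0.
have [_ [U [AU dU] <-] ltU] := lb_ereal_inf_adherent e20 Afin.
have [_ [V [BV dV] <-] ltV] := lb_ereal_inf_adherent e20 Bfin.
(* The two nearly optimal covers are interleaved: [U] at even indices, [V] at odd ones, so the first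
   [2m] terms of [W] are the first [m] of each. *)
pose W i := if odd i then V i./2 else U i./2.
have WE : delta_cover delta (A `|` B) W.
  split=> [x [/AU|/BV] [i _ xi]|i]; last by rewrite /W; case: odd.
    by exists i.*2 => //; rewrite /W odd_double doubleK.
  by exists i.*2.+1 => //; rewrite /W /= odd_double /= uphalf_double.
have sumW m : (\sum_(0 <= i < m.*2) diam_pow n (W i) =
    \sum_(0 <= i < m) diam_pow n (U i) + \sum_(0 <= i < m) diam_pow n (V i))%E.
  elim: m => [|m IH]; first by rewrite double0 !big_nil adde0.
  rewrite doubleS !big_nat_recr//= IH.
  rewrite [W m.*2]/W [W m.*2.+1]/W /= odd_double /= uphalf_double doubleK.
  by rewrite -[LHS]addeA addeACA.
apply: (le_trans (hausdorff_content_le WE)).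
rewrite [e]splitr EFinD addeACA.
apply: (le_trans _ (leeD (ltW ltU) (ltW ltV))).
apply: nneseries_le => [i|m]; first exact: diam_pow_ge0.
apply: (@le_trans _ _ (\sum_(0 <= i < m.*2) diam_pow n (W i))%E).
  apply: lee_sum_nneg_natr => // [i _ _|]; first exact: diam_pow_ge0.
  by rewrite -addnn leq_addr.
by rewrite sumW leeD// nneseries_lim_ge// => *; exact: diam_pow_ge0.
Qed.

(** Covers of [A] are carried along by the map. The mesh bound scales too, which is harmless once
    the supremum over all [delta] is taken. *)
Lemma hausdorff_content_homothety delta t v A : 0 < t ->
  (hausdorff_content n (t * delta) [set (t *: x + v)%R | x in A] <=
   (t ^+ n)%:E * hausdorff_content n delta A)%E.
Proof.
move=> t0; have tn0 : 0 < t ^+ n by rewrite exprn_gt0.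
rewrite -lee_pdivrMl//; apply: le_ereal_inf_tmp => _ [U [AU dU] <-].
rewrite lee_pdivrMl// -nneseriesZl => [|i _]; last exact: diam_pow_ge0.
apply: (le_trans (@hausdorff_content_le _ _ (fun i => [set (t *: x + v)%R | x in U i]) _)).
  split=> [_ [x /AU [i _ xi] <-]|i]; first by exists i => //; exists x.
  apply: (le_trans (diam_homothety _ _ (ltW t0))).
  by rewrite EFinM lee_wpmul2l// lee_fin ltW.
apply: lee_nneseries => [i _ _|i _]; first exact: diam_pow_ge0.
by apply: diam_pow_homothety; exact: ltW.
Qed.

Lemma unit_ball_volume_gt0 m : 0 < unit_ball_volume R m.
Proof.
(* The recursion goes down by two, so the induction carries two consecutive values. *)
suff: 0 < unit_ball_volume R m /\ 0 < unit_ball_volume R m.+1 by case.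
elim: m => [|m [IH0 IH1]]; first by split => /=.
by split => //; rewrite /= !mulr_gt0 ?invr_gt0 ?pi_gt0.
Qed.

Lemma hausdorff_constant_gt0 : 0 < unit_ball_volume R n / 2 ^+ n.
Proof. by rewrite divr_gt0 ?unit_ball_volume_gt0 ?exprn_gt0. Qed.

Lemma hausdorff_constant_ge0 : (0 <= (unit_ball_volume R n / 2 ^+ n)%:E)%E.
Proof. by rewrite lee_fin ltW// hausdorff_constant_gt0. Qed.

Lemma ereal_sup_content_ge0 A :
  (0 <= ereal_sup [set hausdorff_content n delta A | delta in [set delta : R | (0 < delta)%R]])%E.
Proof.
apply: (le_trans (hausdorff_content_ge0 1 A)); apply: ereal_sup_ubound.
by exists 1 => /=.
Qed.

Lemma hausdorff_measure_ge0 A : (0 <= hausdorff_measure n A)%E.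
Proof.
by rewrite mule_ge0 ?ereal_sup_content_ge0// lee_fin ltW ?hausdorff_constant_gt0.
Qed.

Lemma hausdorff_measureS A B : A `<=` B ->
  (hausdorff_measure n A <= hausdorff_measure n B)%E.
Proof.
move=> AB; rewrite /hausdorff_measure lee_wpmul2l ?hausdorff_constant_ge0//.
apply: ge_ereal_sup => _ [delta d0 <-].
apply: (le_trans (hausdorff_contentS delta AB)); apply: ereal_sup_ubound.
by exists delta.
Qed.

Lemma hausdorff_measureU A B :
  (hausdorff_measure n (A `|` B) <= hausdorff_measure n A + hausdorff_measure n B)%E.
Proof.
rewrite /hausdorff_measure -ge0_muleDr ?ereal_sup_content_ge0//.
rewrite lee_wpmul2l ?hausdorff_constant_ge0//.
apply: ge_ereal_sup => _ [delta d0 <-].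
apply: (le_trans (hausdorff_contentU delta A B)).
by rewrite leeD//; apply: ereal_sup_ubound; exists delta.
Qed.

Lemma hausdorff_measureU_bigcup (I : Type) (s : seq I) A (F : I -> set 'rV[R]_k) :
  (hausdorff_measure n (A `|` \big[setU/set0]_(i <- s) F i) <=
   hausdorff_measure n A + \sum_(i <- s) hausdorff_measure n (F i))%E.
Proof.
elim: s A => [|i s IH] A; first by rewrite !big_nil setU0 adde0.
rewrite !big_cons setUA addeA; apply: (le_trans (IH _)).
by rewrite leeD2r// hausdorff_measureU.
Qed.

Lemma hausdorff_measure_homothety t v A : 0 < t ->
  (hausdorff_measure n [set (t *: x + v)%R | x in A] <=
   (t ^+ n)%:E * hausdorff_measure n A)%E.
Proof.
move=> t0; rewrite /hausdorff_measure muleCA.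
rewrite lee_wpmul2l ?hausdorff_constant_ge0//.
apply: ge_ereal_sup => _ [delta d0 <-].
have <- : t * (t^-1 * delta) = delta by rewrite mulVKf// gt_eqF.
apply: (le_trans (hausdorff_content_homothety _ _ _ t0)).
rewrite lee_wpmul2l ?lee_fin ?(exprn_ge0 _ (ltW t0))//; apply: ereal_sup_ubound.
by exists (t^-1 * delta) => //=; rewrite mulr_gt0 ?invr_gt0.
Qed.

End HausdorffMeasure.

(** * Finiteness of the volume of the simplex *)

Section SimplexVolume.
Context (R : realType) (n : nat).
Hypothesis n0 : (0 < n)%N.
Implicit Types (x y : 'rV[R]_n.+1) (e : R).

Lemma simplex_coord_le1 x i : simplex R n.+1 x -> x 0 i <= 1.
Proof. by case=> x0 <-; rewrite (bigD1 i)//= lerDl sumr_ge0. Qed.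

(** Coordinate 0 is 1 minus the sum of the [n] others, so it varies by at most [n * e]. *)
Lemma simplex_dist_le x y e : simplex R n.+1 x -> simplex R n.+1 y ->
  (forall j, `|x 0 (lift ord0 j) - y 0 (lift ord0 j)| <= e) ->
  euclid_dist x y <= n.+1%:R * (n%:R * e).
Proof.
move=> [_ sx] [_ sy] xye.
have e0 : 0 <= e by apply: le_trans (normr_ge0 _) (xye (Ordinal n0)).
apply: euclid_dist_le => [|i]; first by rewrite mulr_ge0.
case: (unliftP ord0 i) => [j ->|->].
  by rewrite (le_trans (xye j))// ler_peMl// ler1n n0.
move: sx sy; rewrite !big_ord_recl => /(canRL (addrK _)) -> /(canRL (addrK _)) ->.
rewrite opprB addrC addrA subrK -sumrB; apply: (le_trans (ler_norm_sum _ _ _)).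
apply: (@le_trans _ _ (\sum_(j < n) e)); last by rewrite sumr_const card_ord mulr_natl.
by apply: ler_sum => j _; rewrite distrC.
Qed.

(** A grid of mesh [1 / N] on the last [n] coordinates gives [(N + 1) ^ n] cells of diameter at most
    [c / N], and [(N + 1) / N <= 2] makes the bound uniform in [delta]. *)
Lemma hausdorff_content_simplex_le (delta : R) : 0 < delta ->
  (hausdorff_content n delta (simplex R n.+1) <= ((2 * (n.+1%:R * n%:R)) ^+ n)%:E)%E.
Proof.
move=> d0; set c : R := n.+1%:R * n%:R.
have c0 : 0 <= c by rewrite mulr_ge0.
pose N := (Num.truncn (c / delta)).+1.
have N0 : 0 < N%:R :> R by rewrite ltr0n.
have cN0 : 0 <= c / N%:R by rewrite divr_ge0.
have cN : c / N%:R <= delta.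
  rewrite ler_pdivrMr// mulrC -ler_pdivrMr//; apply/ltW.
  by have /andP[] := truncn_itv (divr_ge0 c0 (ltW d0)).
(* There are [N + 1] values per coordinate, since a coordinate equal to 1 truncates to [N]. *)
pose T := {ffun 'I_n -> 'I_N.+1}.
pose cell (f : T) := [set x | simplex R n.+1 x /\
  forall j, Num.truncn (N%:R * x 0 (lift ord0 j)) = f j].
(* The finitely many cells are listed as a sequence and padded with empty sets, which weigh 0. *)
pose U i := if insub i is Some j then cell (@enum_val T predT j) else set0.
have diam_cell f : (diam (cell f) <= (c / N%:R)%:E)%E.
  apply: diam_le => [|x y [Ex fx] [Ey fy]]; first by rewrite lee_fin.
  rewrite lee_fin /c -mulrA; apply: simplex_dist_le => // j.
  have x0 : 0 <= N%:R * x 0 (lift ord0 j) by rewrite mulr_ge0//; case: Ex.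
  have y0 : 0 <= N%:R * y 0 (lift ord0 j) by rewrite mulr_ge0//; case: Ey.
  move: (truncn_itv x0) (truncn_itv y0); rewrite fx fy -natr1 => /andP[x1 x2] /andP[y1 y2].
  rewrite -(ler_pM2l N0) mulfV ?gt_eqF// -{1}(gtr0_norm N0) -normrM ler_norml.
  by rewrite mulrBr; apply/andP; split; lra.
have diamU i : (diam (U i) <= (c / N%:R)%:E)%E.
  by rewrite /U; case: insub => [j|]//; rewrite diam_set0 lee_fin.
apply: (le_trans (@hausdorff_content_le _ _ _ _ _ U _)).
  split=> [x Ex|i]; last by rewrite (le_trans (diamU i)).
  pose f : T := [ffun j => inord (Num.truncn (N%:R * x 0 (lift ord0 j)))].
  exists (enum_rank f) => //; rewrite /U valK enum_rankK; split=> // j.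
  rewrite ffunE inordK// ltnS -(ler_nat R).
  have x0 : 0 <= N%:R * x 0 (lift ord0 j) by rewrite mulr_ge0//; case: Ex.
  have /andP[/le_trans-> //] := truncn_itv x0.
  by rewrite ler_piMr// simplex_coord_le1.
apply: nneseries_le => [i|m]; first exact: diam_pow_ge0.
pose b : R := (c / N%:R) ^+ n.
have b0 : 0 <= b by rewrite exprn_ge0.
apply: (@le_trans _ _ ((minn m #|T|)%:R * b)%:E).
  elim: m => [|m IH]; first by rewrite big_nil min0n mul0r.
  rewrite big_nat_recr//=; have [mT|Tm] := ltnP m #|T|.
    rewrite (minn_idPl mT) -natr1 mulrDl mul1r EFinD leeD//.
      by rewrite (minn_idPl (ltnW mT)) in IH.
    by rewrite diam_powE// EFin_expe lee_exp2 ?diam_ge0.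
  rewrite (minn_idPr (leqW Tm)) {2}/U insubF ?ltnNge ?Tm//.
  by rewrite diam_pow_set0 adde0 -(minn_idPr Tm).
rewrite lee_fin (@le_trans _ _ (#|T|%:R * b))// ?ler_wpM2r ?ler_nat ?geq_minr//.
rewrite card_ffun !card_ord natrX /b -exprMn lerXn2r ?nnegrE ?mulr_ge0 ?invr_ge0//.
rewrite mulrCA mulrC ler_wpM2r// -natr1 ler_pdivrMr//.
suff: 1 <= N%:R :> R by lra.
by rewrite ler1n.
Qed.

Lemma hausdorff_measure_simplex_lty : (hausdorff_measure n (simplex R n.+1) < +oo)%E.
Proof.
apply: (@le_lt_trans _ _ ((unit_ball_volume R n / 2 ^+ n)%:E *
    ((2 * (n.+1%:R * n%:R)) ^+ n)%:E)%E); last by rewrite -EFinM ltry.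
rewrite lee_wpmul2l ?hausdorff_constant_ge0//; apply: ge_ereal_sup => _ [delta d0 <-].
exact: hausdorff_content_simplex_le.
Qed.

End SimplexVolume.

(** * Covers of a cube by boxes: counting grid points, and compactness *)

Section BallCovers.
Context (R : realType) (n : nat).
Implicit Types (c : nat -> 'rV[R]_n) (e : nat -> R) (b : R).

(** Two grid indices in an interval of length [2 * r] differ by less than [2 * r * s], so
    subtracting the smallest one injects them into ['I_L.+1]. *)
Lemma card_grid_interval (M : nat) (x r s : R) : 0 <= r -> 0 < s ->
  #|[set a : 'I_M | `|x - a%:R / s| < r]%SET|%:R <= 2 * r * s + 1.
Proof.
move=> r0 s0; set A := [set _ | _]%SET.
have rs0 : 0 <= 2 * r * s by rewrite !mulr_ge0// ltW.
have [->|[a1 Aa1]] := set_0Vmem A; first by rewrite cards0 addr_ge0.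
have [a0 Aa0 a0min] : exists2 a0, a0 \in A & forall a, a \in A -> (a0 <= a)%N.
  by case: (@arg_minnP _ a1 (mem A) val Aa1) => a0 ? ?; exists a0.
pose L := Num.truncn (2 * r * s).
have /andP[Lle _] := truncn_itv rs0.
apply: (@le_trans _ _ L.+1%:R); last by rewrite -natr1 lerD2r.
rewrite ler_nat -[leqRHS]card_ord.
have AL a : a \in A -> (a - a0 < L.+1)%N.
  move=> Aa; rewrite ltnS truncn_ge_nat// natrB ?a0min//.
  move: Aa Aa0; rewrite !inE !ltr_norml => /andP[h1 _] /andP[_ h2].
  have : a%:R / s - a0%:R / s < 2 * r by lra.
  by rewrite -mulrBl ltr_pdivrMr// => /ltW.
apply: (@leq_card_in _ _ (fun a : 'I_M => inord (a - a0) : 'I_L.+1) (mem A)).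
move=> a b Aa Ab /(congr1 val); rewrite /= !inordK ?AL// => /eqP.
by rewrite eqn_sub2rE ?a0min// => /eqP/val_inj.
Qed.

(** Shaped after [card_family], which gives the cardinality of a product as a [foldr]. *)
Lemma leq_foldr_muln (s : seq nat) (r : R) :
  (forall a, a \in s -> a%:R <= r) -> (foldr muln 1%N s)%:R <= r ^+ size s.
Proof.
elim: s => [|a s IH] h //=.
rewrite natrM exprS ler_pM//; first by rewrite h// mem_head.
by apply: IH => u us; rewrite h// inE us orbT.
Qed.

(* Each box meets at most [3 e_i / mesh] grid points per coordinate once the
   mesh is finer than every [e_i]. *)
Lemma cube_box_cover_le b m c e : 0 < b -> (forall i, 0 < e i) ->
  (forall y : 'rV[R]_n, (forall j, 0 <= y 0 j <= b) ->
    exists2 i, (i < m)%N & forall j, `|c i 0 j - y 0 j| < e i) ->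
  b ^+ n <= \sum_(i < m) (3 * e i) ^+ n.
Proof.
move=> b0 e0 cov.
pose M := (\sum_(i < m) (Num.truncn (b / e i)).+1).+1.
have M0 : 0 < M%:R :> R by rewrite ltr0n.
pose s := M%:R / b; have s0 : 0 < s by rewrite divr_gt0.
have es (i : 'I_m) : 1 <= e i * s.
  rewrite mulrA ler_pdivlMr// mul1r -ler_pdivrMl// mulrC; apply: ltW.
  have /andP[_ /lt_le_trans-> //] := truncn_itv (ltW (divr_gt0 b0 (e0 i))).
  by rewrite ler_nat /M (bigD1 i)//= -addSn ltnW// ltnS leq_addr.
pose A (i : 'I_m) j := [set a : 'I_M | `|c i 0 j - a%:R / s| < e i]%SET.
(* [F i] is the set of grid points of spacing [1 / s] lying in box [i], a product over the
   coordinates. *)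
pose F (i : 'I_m) := family (fun j => mem (A i j) : pred 'I_M).
have cardF i : #|F i|%:R <= (3 * e i * s) ^+ n.
  rewrite card_family.
  have := @leq_foldr_muln [seq #|A i j| | j : 'I_n] (3 * e i * s).
  rewrite size_image card_ord => le_foldr; apply: le_foldr => _ /fintype.imageP[j _ ->].
  apply: (le_trans (card_grid_interval _ _ (ltW (e0 i)) s0)).
  by have := es i; lra.
have covF (f : {ffun 'I_n -> 'I_M}) : exists i, f \in F i.
  have [|i im h] := cov (\row_j ((f j)%:R / s)).
    move=> j; rewrite mxE divr_ge0 ?(ltW s0)//= ler_pdivrMr// /s mulrCA divff ?gt_eqF// mulr1.
    by rewrite ler_nat ltnW.
  exists (Ordinal im); apply/familyP => j; rewrite !inE.
  by have := h j; rewrite mxE.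
(* Double counting: each of the [M ^ n] grid points lies in at least one box. *)
have : (M ^ n <= \sum_(i < m) #|F i|)%N.
  rewrite -{1}(card_ord M) -{1}(card_ord n) -card_ffun -sum1_card.
  under [leqRHS]eq_bigr do rewrite -sum1_card big_mkcond.
  rewrite exchange_big/= leq_sum// => f _.
  by have [i fi] := covF f; rewrite (bigD1 i)//= fi leq_addr.
rewrite -(ler_nat R) natrX natr_sum => MF.
have sM : M%:R = s * b by rewrite /s divfK// gt_eqF.
rewrite -(ler_pM2l (exprn_gt0 n s0)) -exprMn -sM (le_trans MF)// mulr_sumr.
by apply: ler_sum => i _; rewrite -exprMn [s * _]mulrC.
Qed.

(** The boxes are open balls of the sup norm and the cube is a product of compact segments; [m]
    exceeds every index in a finite subcover. *)
Lemma cube_box_compact b c e : (forall i, 0 < e i) ->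
  (forall y : 'rV[R]_n, (forall j, 0 <= y 0 j <= b) ->
    exists i, forall j, `|c i 0 j - y 0 j| < e i) ->
  exists m, forall y : 'rV[R]_n, (forall j, 0 <= y 0 j <= b) ->
    exists2 i, (i < m)%N & forall j, `|c i 0 j - y 0 j| < e i.
Proof.
move=> e0 cov.
have := @rV_compact R n (fun=> `[0, b]%classic) (fun=> @segment_compact R 0 b).
rewrite compact_cover => /(_ nat setT (fun i => ball (c i) (e i))).
case=> [i _|y /= yb|D _ Dcov].
- exact: ball_open.
- have [j|i h] := cov y; first by have := yb j; rewrite in_itv.
  by exists i => //; split => // k j; rewrite !ord1; exact: h.
exists (\max_(i <- finmap.enum_fset D) i).+1 => y yb.
have [|i /= iD [_ h]] := Dcov y; first by move=> j; rewrite /= in_itv yb.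
by exists i => [|j]; [rewrite ltnS leq_bigmax_seq|exact: h].
Qed.

End BallCovers.

(** * Positivity of the volume of the simplex *)

Section SimplexPositive.
Context (R : realType) (n : nat).
Hypothesis n0 : (0 < n)%N.

(** The side [1 / n] keeps the sum of [n] coordinates at most 1, so the missing coordinate
    [1 - \sum_j y 0 j] is nonnegative. *)
Lemma simplex_lift (y : 'rV[R]_n) : (forall j, 0 <= y 0 j <= n%:R^-1) ->
  exists2 x, simplex R n.+1 x & forall j, x 0 (lift ord0 j) = y 0 j.
Proof.
move=> yb.
pose x : 'rV[R]_n.+1 := \row_i oapp (fun j => y 0 j) (1 - \sum_j y 0 j) (unlift ord0 i).
have xl j : x 0 (lift ord0 j) = y 0 j by rewrite mxE liftK.
have x0 : x 0 ord0 = 1 - \sum_j y 0 j by rewrite mxE unlift_none.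
exists x => //; split=> [i|].
  case: (unliftP ord0 i) => [j ->|->]; first by rewrite xl; case/andP: (yb j).
  rewrite x0 subr_ge0 (@le_trans _ _ (\sum_(j < n) n%:R^-1))//.
    by apply: ler_sum => j _; case/andP: (yb j).
  by rewrite sumr_const card_ord -[_ *+ n]mulr_natl mulfV// pnatr_eq0 -lt0n.
by rewrite big_ord_recl x0 (eq_bigr _ (fun j _ => xl j)) subrK.
Qed.

Lemma hausdorff_content_simplex_ge (delta : R) :
  (((n%:R^-1 / 6) ^+ n)%:E <= hausdorff_content n delta (simplex R n.+1))%E.
Proof.
set b : R := n%:R^-1; have b0 : 0 < b by rewrite invr_gt0 ltr0n.
apply: le_ereal_inf_tmp => _ [U [EU dU] <-].
have dfin i : diam (U i) \is a fin_num.
  rewrite ge0_fin_numE; last exact: diam_ge0.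
  exact: le_lt_trans (dU i) (ltry _).
pose d i := fine (diam (U i)).
have d0 i : 0 <= d i by rewrite fine_ge0 ?diam_ge0.
have dE i : diam_pow n (U i) = (d i ^+ n)%:E.
  by rewrite diam_powE// EFin_expe fineK.
apply/lee_addgt0Pr => eps eps0.
(* The enlargements make every box radius positive, even for a set of diameter 0. Their sum is at
   most [eps], and the cap at 1 yields [eta i ^+ n <= eta i]. *)
pose eta i : R := Num.min eps 1 / 2 ^+ i.+1.
have min0 : 0 < Num.min eps 1 by rewrite lt_min eps0 ltr01.
have eta0 i : 0 < eta i by rewrite divr_gt0// exprn_gt0.
have eta1 i : eta i <= 1.
  by rewrite ler_pdivrMr ?exprn_gt0// mul1r ge_min exprn_ege1 ?ler1n ?orbT.
have sum_eta m : \sum_(i < m) eta i <= eps.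
  have -> : \sum_(i < m) eta i = Num.min eps 1 * (1 - 2^-1 ^+ m).
    elim: m => [|m IH]; first by rewrite big_ord0 expr0 subrr mulr0.
    rewrite big_ord_recr/= IH /eta !exprVn !exprS; field.
    by rewrite expf_neq0 // pnatr_eq0.
  rewrite (@le_trans _ _ (Num.min eps 1))// ?ge_min ?lexx//.
  by rewrite ler_piMr ?(ltW min0)// lerBlDr lerDl exprn_ge0.
(* Box centers are projections of chosen points of [U i]. The default 0 occurs only for empty [U i],
   which contain no lifted point. *)
pose x i : 'rV[R]_n := \row_j (xget 0 (U i)) 0 (lift ord0 j).
pose e i := d i + eta i.
have e0 i : 0 < e i by rewrite ltr_wpDl.
have [|m hm] := @cube_box_compact R n b x e e0.
  move=> y /simplex_lift[z /EU[i _ Uz] zy]; exists i => j.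
  rewrite mxE -zy; apply: le_lt_trans (coord_le_euclid_dist _ _ _) _.
  have Ux : U i (xget 0 (U i)) by apply: xgetPex; exists z.
  have := euclid_dist_le_diam Ux Uz; rewrite -(fineK (dfin i)) lee_fin => /le_lt_trans->//.
  by rewrite /e ltrDl.
have := cube_box_cover_le b0 e0 hm.
(* The 6 is [3 * 2], from bounding [d i + eta i] by twice the maximum; the power of the maximum is
   then one of the two powers. *)
have pow_le (i : 'I_m) : (3 * e i) ^+ n <= 6 ^+ n * (d i ^+ n + eta i).
  apply: (@le_trans _ _ ((6 * Num.max (d i) (eta i)) ^+ n)).
    have M1 : d i <= Num.max (d i) (eta i) by rewrite le_max lexx.
    have M2 : eta i <= Num.max (d i) (eta i) by rewrite le_max lexx orbT.
    have dpos := d0 i; have etapos := ltW (eta0 i).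
    by rewrite lerXn2r ?nnegrE /e; move: M1 M2 dpos etapos; lra.
  rewrite exprMn ler_wpM2l ?exprn_ge0//.
  have etan : eta i ^+ n <= eta i.
    by rewrite -(prednK n0) exprS ler_piMr ?exprn_ile1 ?(ltW (eta0 i)).
  have := exprn_ge0 n (d0 i); have := eta0 i.
  by rewrite maxEle; case: ifP; lra.
move=> /le_trans/(_ (ler_sum _ (fun i _ => pow_le i))).
rewrite -mulr_sumr -ler_pdivrMl ?exprn_gt0// mulrC -exprVn -exprMn big_split/= => ble.
apply: (@le_trans _ _ (\sum_(i < m) d i ^+ n + \sum_(i < m) eta i)%:E); first by rewrite lee_fin.
rewrite EFinD leeD ?lee_fin//.
rewrite -sumEFin -(big_mkord xpredT (fun i => (d i ^+ n)%:E)).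
under eq_bigr do rewrite -dE.
by apply: nneseries_lim_ge => *; exact: diam_pow_ge0.
Qed.

Lemma hausdorff_measure_simplex_gt0 : (0 < hausdorff_measure n (simplex R n.+1))%E.
Proof.
rewrite mule_gt0 ?lte_fin ?hausdorff_constant_gt0//.
apply: (@lt_le_trans _ _ ((n%:R^-1 / 6 : R) ^+ n)%:E).
  by rewrite lte_fin exprn_gt0// divr_gt0// invr_gt0 ltr0n.
apply: (le_trans (hausdorff_content_simplex_ge 1)).
by apply: ereal_sup_ubound; exists 1 => /=.
Qed.

End SimplexPositive.

(** * The corners cut off by the ball, and the volume ratio in fixed dimension *)

Section Corners.
Context (R : realType) (r : R).
Hypothesis hr : 1 / 2 <= r < 1.

(* The corners of the simplex cut off by [Omega] have this size: it is the
   smaller root of [x ^ 2 + (1 - x) ^ 2 = r]. *)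
Definition corner_size : R := (1 - Num.sqrt (2 * r - 1)) / 2.

Let s0 : 0 <= 2 * r - 1.
Proof. by move: hr => /andP[h1 _]; lra. Qed.

(** Identifies the base of the power in the final bound as the square of the homothety ratio, which
    explains the exponent [(k - 1) / 2]. *)
Lemma sqr_corner_size : corner_size ^+ 2 = (r - Num.sqrt (2 * r - 1)) / 2.
Proof.
rewrite /corner_size; have := sqr_sqrtr s0; set s := Num.sqrt _ => s2.
have -> : r = (s ^+ 2 + 1) / 2 by rewrite s2; field.
by field.
Qed.

Lemma corner_size_gt0 : 0 < corner_size.
Proof.
rewrite divr_gt0// subr_gt0 -[ltRHS]sqrtr1 ltr_sqrt//.
by move: hr => /andP[_ h2]; lra.
Qed.

Lemma corner_size_le_half : corner_size <= 1 / 2.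
Proof. by have := sqrtr_ge0 (2 * r - 1); rewrite /corner_size; lra. Qed.

Lemma large_coord (k : nat) (x : 'rV[R]_k.+1) : simplex R k.+1 x -> r < sqnorm x ->
  exists i, 1 - corner_size <= x 0 i.
Proof.
move=> [x0 sx] rx.
have [i _ imax] := @arg_maxP _ R _ ord0 xpredT (fun i => x 0 i) isT.
exists i; have xi0 := x0 i.
have le1 : sqnorm x <= x 0 i.
  rewrite /sqnorm -[leRHS]mulr1 -sx mulr_sumr; apply: ler_sum => j _.
  by rewrite expr2 ler_wpM2r//; exact: imax.
have le2 : sqnorm x <= x 0 i ^+ 2 + (1 - x 0 i) ^+ 2.
  have -> : 1 - x 0 i = \sum_(j < k.+1 | j != i) x 0 j.
    by rewrite -sx (bigD1 i)//= addrAC subrr add0r.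
  rewrite /sqnorm (bigD1 i)//= lerD2l.
  rewrite [leRHS]expr2 mulr_suml; apply: ler_sum => j ji.
  rewrite expr2 ler_wpM2l// (bigD1 j)//= lerDl sumr_ge0// => l _; exact: x0.
(* The first bound gives [x 0 i > r >= 1 / 2]. This sign selects the larger root when the square
   root of the second bound is taken. *)
have u0 : 0 <= 2 * x 0 i - 1 by move: hr => /andP[h1 _]; lra.
have : Num.sqrt (2 * r - 1) <= 2 * x 0 i - 1.
  rewrite -[leRHS]ger0_norm// -sqrtr_sqr ler_wsqrtr//.
  have -> : (2 * x 0 i - 1) ^+ 2 = 2 * (x 0 i ^+ 2 + (1 - x 0 i) ^+ 2) - 1 by ring.
  by lra.
by rewrite /corner_size; lra.
Qed.

(** The image of the simplex under the homothety centered at its [i]-th vertex. *)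
Definition corner (k : nat) (i : 'I_k) : set 'rV[R]_k :=
  [set corner_size *: x + (1 - corner_size) *: delta_mx 0 i | x in simplex R k].

Lemma corner_large_coord (k : nat) (x : 'rV[R]_k) i :
  simplex R k x -> 1 - corner_size <= x 0 i -> corner i x.
Proof.
have t0 := corner_size_gt0; have tn0 : corner_size != 0 by rewrite gt_eqF.
move=> [x0 sx] xi.
(* The inverse homothety keeps the coordinate sum 1; nonnegativity of the [i]-th coordinate is
   exactly the assumption on [x 0 i]. *)
exists (corner_size^-1 *: (x - (1 - corner_size) *: delta_mx 0 i)); last first.
  by rewrite scalerA mulfV// scale1r subrK.
split=> [j|].
  rewrite !mxE mulr_ge0 ?invr_ge0 ?(ltW t0)// eqxx/=.
  by case: eqVneq => [->|_]; rewrite ?mulr1 ?mulr0 ?subr0// subr_ge0.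
under eq_bigr do rewrite !mxE.
rewrite -mulr_sumr sumrB sx (bigD1 i)//= !eqxx big1 ?addr0 => [|j /negPf ->].
  by rewrite mulr1 subKr mulVf.
by rewrite mulr0.
Qed.

Lemma simplex_subset (k : nat) :
  simplex R k.+1 `<=` Omega k.+1 r `|` \big[setU/set0]_(i < k.+1) corner i.
Proof.
move=> x Ex; have [xr|rx] := leP (sqnorm x) r; first by left.
right; have [i xi] := large_coord Ex rx.
by rewrite (bigD1 i)//=; left; apply: corner_large_coord.
Qed.

Lemma Vol_Omega_ratio (n : nat) : (0 < n)%N ->
  ((1 - n.+1%:R * corner_size ^+ n)%:E <= Vol (Omega n.+1 r) / Vol (simplex R n.+1))%E /\
  (Vol (Omega n.+1 r) / Vol (simplex R n.+1) <= 1)%E.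
Proof.
move=> n0; rewrite /Vol /=.
have OE : Omega n.+1 r `<=` simplex R n.+1 by move=> x [].
have := le_trans (hausdorff_measureS n (@simplex_subset n)) (hausdorff_measureU_bigcup _ _ _ _).
have := hausdorff_measureS n OE.
have := hausdorff_measure_simplex_gt0 R n0; have := hausdorff_measure_simplex_lty R n0.
have := hausdorff_measure_ge0 n (Omega n.+1 r).
have corner_le i : (hausdorff_measure n (@corner n.+1 i) <=
    (corner_size ^+ n)%:E * hausdorff_measure n (simplex R n.+1))%E.
  exact: hausdorff_measure_homothety corner_size_gt0.
move=> O0 Elty E0 OleE /le_trans/(_ (leeD2l _ (lee_sum _ (fun i _ => corner_le i)))).
have : hausdorff_measure n (Omega n.+1 r) \is a fin_num.
  by rewrite ge0_fin_numE//; exact: le_lt_trans Elty.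
have : hausdorff_measure n (simplex R n.+1) \is a fin_num.
  by rewrite ge0_fin_numE// ltW.
move: E0 OleE => + + /fineK Efin /fineK Ofin.
rewrite -Efin -Ofin; set V := fine _; set W := fine _; rewrite lte_fin lee_fin => V0 WV.
(* Both volumes are now real, and [0 < V] makes the extended inverse the real one. *)
rewrite sumEFin sumr_const card_ord -EFinD lee_fin inver gt_eqF// -EFinM !lee_fin => le.
by rewrite ler_pdivlMr// ler_pdivrMr// mul1r; split=> //; rewrite -mulr_natl in le; lra.
Qed.

End Corners.

(** * Decay of the error term, the bound for all dimensions, and the limit *)

Lemma sqr_le_exp2 (n : nat) : (n.+1 ^ 2 <= 4 * 2 ^ n)%N.
Proof.
(* [(n + 2) ^ 2 <= 2 * (n + 1) ^ 2] fails for [n] below 2, so the induction starts there. *)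
case: n => [|[|n]] //; elim: n => [|n IH] //.
by move: IH; rewrite !expnS !expn0; set p := (2 ^ n)%N; nia.
Qed.

(** Exponential decay is weakened to a multiple of [harmonic], whose limit 0 is known. *)
Lemma mul_exp_le_harmonic (R : realType) (t : R) (n : nat) : 0 <= t -> t <= 1 / 2 ->
  n.+1%:R * t ^+ n <= 4 * n.+1%:R^-1.
Proof.
move=> t0 t2.
have tn : t ^+ n <= (2 ^+ n)^-1.
  by rewrite -exprVn lerXn2r ?nnegrE// -div1r.
apply: (le_trans (ler_wpM2l _ tn)); first exact: ler0n.
rewrite ler_pdivrMr ?exprn_gt0// mulrAC ler_pdivlMr ?ltr0n//.
by have := sqr_le_exp2 n; rewrite -(ler_nat R) natrM !natrX expr2.
Qed.

Theorem lemma3p2 (R : realType) (r : R) (hr : 1 / 2 <= r < 1) :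
  (forall k : nat, (2 <= k)%N ->
    ((1 - k%:R * ((r - Num.sqrt (2 * r - 1)) / 2) `^ ((k%:R - 1) / 2))%:E
     <= Vol (Omega k r) / Vol (simplex R k))%E)
  /\ (fun k : nat => (Vol (Omega k r) / Vol (simplex R k))%E) @ \oo --> 1%E.
Proof.
have t0 := corner_size_gt0 hr.
split=> [[|[|n]] // _|].
  have [+ _] := Vol_Omega_ratio hr (ltn0Sn n).
  congr (_ <= _)%E; congr (_ - _ * _)%:E.
  rewrite -(sqr_corner_size hr) -[in RHS]powR_mulrn ?(ltW t0)// -powRrM.
  by rewrite -powR_mulrn ?(ltW t0)//; congr (_ `^ _); rewrite -(natr1 n.+1); field.
suff : (fun n => Vol (Omega n.+1 r) / Vol (simplex R n.+1))%E @ \oo --> 1%E.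
  by move=> h; rewrite -cvg_shiftS; exact: h.
(* Since [corner_size <= 1 / 2], the lower bound on the ratio is at least [1 - 4 * harmonic n]; the
   upper bound is 1. *)
apply: (squeeze_cvge (f := fun n => (1 - 4 * harmonic n)%:E) (h := fun=> 1%E)).
- near=> n.
  have n0 : (0 < n)%N by near: n; exact: nbhs_infty_gt.
  have [h1 ->] := Vol_Omega_ratio hr n0; rewrite andbT (le_trans _ h1)// lee_fin lerD2l lerN2.
  by rewrite mul_exp_le_harmonic ?(ltW t0) ?corner_size_le_half.
- apply: cvg_EFin; first by near=> n.
  rewrite -[X in _ --> X]subr0 -[X in _ - X](mulr0 4).
  apply: cvgB; first exact: cvg_cst.
  by apply: cvgM; [exact: cvg_cst|exact: cvg_harmonic].
- exact: cvg_cst.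
Unshelve. all: by end_near. Qed.
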